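(* Let $A\in\mathbb{C}^{n\times n}$ and $D\in\mathbb{C}^{m\times m}$ be Hermitian matrices. Let $\lambda_1\geq\lambda_2\geq\ldots\geq\lambda_k>0\geq\lambda_{k+1}\geq\ldots\geq\lambda_n$ be the eigenvalues of $A$ and let $\mu_1\leq\mu_2\leq\ldots\leq\mu_r\leq 0<\mu_{r+1}\leq\ldots\leq\mu_m$ be the eigenvalues of $D$ (in both cases counted with multiplicities), and let $p=\dim(\ker D)$. Let $\kappa>0$. Then the following statements hold. (i) There exists $K\in\mathbb{C}^{n\times m}$ with $\|K\|<\kappa$ such that $D+K^*AK$ is positive definite if and only if $$r\leq k\quad\text{and}\quad \kappa^2\lambda_i+\mu_i>0\ \text{ for all } i=1,\ldots,r-p.$$ (ii) There exists $K\in\mathbb{C}^{n\times m}$ with $\|K\|\leq\kappa$ such that $D+K^*AK$ is positive semidefinite if and only if $$r-p\leq k\quad\text{and}\quad \kappa^2\lambda_i+\mu_i\geq 0\ \text{ for all } i=1,\ldots,r-p.$$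
   Context: $\|K\|$ denotes the spectral norm (largest singular value) of $K$. The integer $k$ is the number of positive eigenvalues of $A$ and $r$ is the number of non-positive eigenvalues of $D$, counted with multiplicities; thus $r-p$ is the number of negative eigenvalues of $D$. Conditions indexed by an empty range of $i$ are vacuous. (The matrix $D+K^*AK$ is the Schur complement $D-(K^*A)A^\dagger(-AK)$ of $A$ in the block matrix $\left[\begin{smallmatrix}A&-AK\\ K^*A&D\end{smallmatrix}\right]$, with $A^\dagger$ the Moore-Penrose inverse of $A$.) *)

(* Defs.v *)
From mathcomp Require Import all_boot all_order all_algebra.
From mathcomp Require Import reals complex.
Set Implicit Arguments.
Unset Strict Implicit.
Unset Printing Implicit Defensive.
Import Order.TTheory GRing.Theory Num.Theory.
Local Open Scope ring_scope.
Local Open Scope sesquilinear_scope.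
Local Open Scope complex_scope.

(* On a Hermitian matrix [spectral_diag] lists the eigenvalues with their
   multiplicities. When n < m there are m - n extra zeros here compared with the
   usual list of min(n, m) singular values, which does not affect the largest. *)
Definition singular_value (R : realType) (n m : nat) (K : 'M[R[i]]_(n, m))
    (j : 'I_m) : R :=
  Num.sqrt (complex.Re (spectral_diag (K^t* *m K) 0 j)).

Definition spectral_norm (R : realType) (n m : nat) (K : 'M[R[i]]_(n, m)) : R :=
  \big[Num.max/0]_(j < m) singular_value K j.

(* The order on [R[i]] only compares numbers with equal imaginary parts, so
   [0 < z] and [0 <= z] entail that z is real. *)
Definition posdefmx (R : realType) (m : nat) (M : 'M[R[i]]_m) : Prop :=
  M \is hermsymmx /\
  forall x : 'cV[R[i]]_m, x != 0 -> 0 < (x^t* *m M *m x) 0 0.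

Definition possemidefmx (R : realType) (m : nat) (M : 'M[R[i]]_m) : Prop :=
  M \is hermsymmx /\
  forall x : 'cV[R[i]]_m, 0 <= (x^t* *m M *m x) 0 0.

Definition eigenvalues_of (R : realType) (n : nat) (A : 'M[R[i]]_n)
    (lambda : 'I_n -> R) : Prop :=
  char_poly A = \prod_(i < n) ('X - ((lambda i)%:C)%:P).

(* The columns of [cokermx D] span the space of column vectors x, D *m x = 0. *)
Definition dim_ker (R : realType) (m : nat) (D : 'M[R[i]]_m) : nat :=
  \rank (cokermx D).

(* Main.v *)
Require Import Defs.
From mathcomp Require Import all_boot all_order all_algebra.
From mathcomp Require Import reals complex.
From mathcomp Require Import perm fingroup zify ring lra.
Import Order.TTheory GRing.Theory Num.Theory.
Local Open Scope ring_scope.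
Local Open Scope sesquilinear_scope.
Local Open Scope complex_scope.

(** Diagonalise [A = U^* diag(lambda) U] and [D = V^* diag(mu) V] with [U] and
    [V] unitary, so that both Hermitian forms become weighted sums of squared
    moduli of coordinates.  The norm bound on [K] enters as
    [|Kx| <= kappa |x|] for all [x] ([spectral_norm_leP]), and the value at [x]
    of the form of [D + K^* A K] is the value of [D] at [x] plus the value of [A]
    at [Kx].

    Necessity is a dimension count in the style of Courant and Fischer
    ([inertia_bound]).  Let [W] be the span of the eigenvectors of [D] that
    belong to a set of [d] eigenvalues, and suppose that the form of [A] at
    [Kx] exceeds [c |Kx|^2] for every nonzero [x] in [W].  If fewer than [d]
    eigenvalues of [A] exceeded [c], some nonzero [x] in [W] would make [Kx]
    orthogonal to all of their eigenvectors, and the form of [A] at [Kx] would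
    be at most [c |Kx|^2].  With [c = 0] and the non-positive (for (ii), the
    negative) eigenvalues of [D], this gives [r <= k] (for (ii),
    [r - p <= k]).  With the eigenvalues up to a negative [mu_i], the form of
    [D] on [W] is at most [mu_i |x|^2 <= mu_i / kappa^2 |Kx|^2], which gives
    [lambda_i > - mu_i / kappa^2]; for (ii) the same holds with every smaller
    non-negative [c], hence [lambda_i >= - mu_i / kappa^2]
    ([eigenvalue_bound]).

    For sufficiency, let [K] send the [i]-th eigenvector of [D] to [s] times the
    [i]-th eigenvector of [A] for [i < q], and the other ones to [0]
    ([exists_diagonal_shift]).  Then [D + K^* A K] is diagonal in the basis [V],
    with entries [mu_i + s^2 lambda_i] for [i < q] and [mu_i] otherwise.  Part
    (ii) takes [q = r - p] and [s = kappa]; part (i) takes [q = r] and some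
    [s < kappa] close enough to [kappa] for the finitely many strict
    inequalities to survive ([exists_smaller_scale]). *)

(** * Hermitian forms and squared norms *)

Section HermitianForms.
Context {C : numClosedFieldType}.

Definition sqnorm {n} (x : 'cV[C]_n) : C := \sum_i `|x i 0| ^+ 2.

Lemma diag_form {n} (d : 'rV[C]_n) (x : 'cV[C]_n) :
  (x^t* *m diag_mx d *m x) 0 0 = \sum_i d 0 i * `|x i 0| ^+ 2.
Proof.
rewrite mxE; apply: eq_bigr => i _.
by rewrite mul_mx_diag !mxE normCK; ring.
Qed.

Lemma sqnormE {n} (x : 'cV[C]_n) : sqnorm x = (x^t* *m x) 0 0.
Proof. by rewrite mxE; apply: eq_bigr => i _; rewrite !mxE normCKC. Qed.

Lemma sqnorm_ge0 {n} (x : 'cV[C]_n) : 0 <= sqnorm x.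
Proof. by apply: sumr_ge0 => i _; rewrite exprn_ge0. Qed.

Lemma sqnorm_eq0 {n} (x : 'cV[C]_n) : (sqnorm x == 0) = (x == 0).
Proof.
apply/idP/eqP => [|->]; last first.
  by rewrite /sqnorm big1 // => i _; rewrite mxE normr0 expr0n.
rewrite psumr_eq0 => [/allP z|i _]; last exact: exprn_ge0.
apply/colP => i; move: (z i (mem_index_enum _)).
by rewrite mxE expf_eq0 normr_eq0 => /eqP.
Qed.

Lemma sqnorm_gt0 {n} (x : 'cV[C]_n) : (0 < sqnorm x) = (x != 0).
Proof. by rewrite lt_def sqnorm_ge0 andbT sqnorm_eq0. Qed.

Lemma adjM {m n p} (M : 'M[C]_(m, n)) (N : 'M[C]_(n, p)) :
  (M *m N)^t* = N^t* *m M^t*.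
Proof. by rewrite trmx_mul map_mxM. Qed.

Lemma unitary_adjK {n} (U : 'M[C]_n) : U \is unitarymx -> U^t* *m U = 1%:M.
Proof. by move=> hU; rewrite -(invmx_unitary hU) mulVmx ?unitarymx_unit. Qed.

Lemma sqnorm_unitary {n} {U : 'M[C]_n} (x : 'cV[C]_n) :
  U \is unitarymx -> sqnorm (U *m x) = sqnorm x.
Proof.
move=> hU.
by rewrite !sqnormE adjM -mulmxA [U^t* *m _]mulmxA unitary_adjK // mul1mx.
Qed.

Lemma hermsymmxE {n} (M : 'M[C]_n) : (M \is hermsymmx) = (M == M^t*).
Proof. by rewrite qualifE /= expr0 scale1r. Qed.

End HermitianForms.

(** * Linear algebra: common kernels, ranks, characteristic polynomials *)

Lemma exists_common_zero {F : fieldType} {n a b} (M : 'M[F]_(a, n))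
    (N : 'M[F]_(b, n)) :
  (a + b < n)%N -> exists x : 'cV[F]_n, [/\ x != 0, M *m x = 0 & N *m x = 0].
Proof.
move=> lt_n; set Q := (col_mx M N)^T.
have : kermx Q != 0.
  rewrite kermx_eq0 /row_free neq_ltn; apply/orP; left.
  exact: leq_ltn_trans (rank_leq_col _) lt_n.
case/rowV0Pn => v /sub_kermxP vQ v0; exists v^T.
have : col_mx M N *m v^T = 0 by rewrite -[LHS]trmxK trmx_mul trmxK vQ trmx0.
rewrite mul_col_mx -col_mx0 => /eq_col_mx [-> ->]; split=> //.
by rewrite -(inj_eq (can_inj (@trmxK _ _ _))) trmxK trmx0.
Qed.

(** With [E] the selection of the coordinates where [d] is nonzero, [E E^T = 1]
    and [diag d = E^T E diag d'] for an invertible [diag d']; the rank is thus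
    that of [E^T E], which is that of [E]. *)
Lemma rank_diag_mx {F : fieldType} {n} (d : 'rV[F]_n) :
  \rank (diag_mx d) = #|[set i | d 0 i != 0]|.
Proof.
set S := [set i | _].
pose E : 'M[F]_(#|S|, n) := \matrix_(a, j) (enum_val a == j)%:R.
pose d' : 'rV[F]_n := \row_i (if i \in S then d 0 i else 1).
have EE : E *m E^T = 1%:M.
  apply/matrixP => a b; rewrite !mxE (bigD1 (enum_val a)) //= big1 => [|j ja].
    by rewrite !mxE eqxx mul1r addr0 eq_sym (inj_eq enum_val_inj).
  by rewrite !mxE [enum_val a == j]eq_sym (negPf ja) mul0r.
have rE : \rank E = #|S|.
  apply/eqP; rewrite eqn_leq rank_leq_row -[X in (X <= _)%N](@mxrank1 F) -EE.
  exact: mxrankM_maxl.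
have Ed : diag_mx d = E^T *m E *m diag_mx d'.
  apply/matrixP => i j; rewrite mul_mx_diag !mxE.
  case: (boolP (i \in S)) => [iS|iS].
    rewrite (bigD1 (enum_rank_in iS i)) //= big1 => [|a ai].
      rewrite !mxE enum_rankK_in // eqxx mul1r addr0.
      by case: eqVneq => [<-|_]; rewrite ?mul0r //= iS mul1r.
    rewrite !mxE; case: eqVneq => [ei|_]; last by rewrite mul0r.
    by case/eqP: ai; apply: enum_val_inj; rewrite enum_rankK_in.
  rewrite big1 ?mul0r => [|a _].
    by move: iS; rewrite inE negbK => /eqP ->; rewrite mul0rn.
  rewrite !mxE; case: eqVneq => [ei|_]; last by rewrite mul0r.
  by move: iS; rewrite -ei enum_valP.
have d'u : diag_mx d' \in unitmx.
  rewrite unitmxE det_diag unitfE; apply/prodf_neq0 => i _; rewrite mxE.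
  by case: ifP => [|_]; rewrite ?oner_eq0 // inE.
rewrite Ed mxrankMfree ?row_free_unit //.
transitivity (\rank E) => //; apply/eqP.
rewrite eqn_leq mxrankM_maxr /=.
by rewrite -[X in (\rank X <= _)%N]mul1mx -EE -mulmxA mxrankM_maxr.
Qed.

Lemma char_poly_conj {F : fieldType} {n} (P M : 'M[F]_n) :
  P \in unitmx -> char_poly (invmx P *m M *m P) = char_poly M.
Proof.
move=> uP; rewrite /char_poly /char_poly_mx.
have PP : map_mx polyC (invmx P) *m map_mx polyC P = 1%:M.
  by rewrite -map_mxM mulVmx // map_mx1.
have -> : 'X%:M - map_mx polyC (invmx P *m M *m P) =
    map_mx polyC (invmx P) *m ('X%:M - map_mx polyC M) *m map_mx polyC P.
  by rewrite mulmxBr mulmxBl !map_mxM scalar_mxC -(mulmxA 'X%:M) PP mulmx1.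
by rewrite !det_mulmx mulrAC -det_mulmx PP det1 mul1r.
Qed.

(** * Initial segments of ordinals *)

Lemma card_ltn_ord n k : (k <= n)%N -> #|[set a : 'I_n | (a < k)%N]| = k.
Proof.
move=> le_kn; rewrite -sum1dep_card -(big_ord_widen n (fun=> 1%N)) //.
by rewrite sum1_card card_ord.
Qed.

(** Turns the cardinalities that count eigenvalues of a given sign into
    conditions on positions in the sorted lists. *)
Lemma mem_initial n (S : {set 'I_n}) (i : 'I_n) :
  (forall a b : 'I_n, (a <= b)%N -> b \in S -> a \in S) ->
  (i \in S) = (i < #|S|)%N.
Proof.
move=> dS; apply/idP/idP => [iS | lt_i].
  rewrite -(@card_ltn_ord n i.+1) //; apply: subset_leq_card.
  by apply/subsetP => a; rewrite inE ltnS => /dS; apply.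
apply: contraLR lt_i => iS; rewrite -leqNgt.
rewrite -[X in (_ <= X)%N](card_ltn_ord n i (ltnW (ltn_ord i))).
apply: subset_leq_card; apply/subsetP => a aS.
by rewrite inE ltnNge; apply: contra iS => /dS; apply.
Qed.

(** * Diagonalisation with a prescribed list of eigenvalues *)

Section Spectral.
Context {R : realType}.
Local Notation C := R[i].

Definition realdiag {n} (d : 'I_n -> R) : 'M[C]_n := diag_mx (\row_i (d i)%:C).

(** The spectral theorem yields a unitary [P] and some list [d] of eigenvalues;
    comparing the two factorisations of the characteristic polynomial, [d] is a
    permutation of [lambda], and permuting the rows of [P] puts the eigenvalues
    in the order of [lambda]. *)
Lemma eigenvalues_diagonalize {n} (A : 'M[C]_n) (lambda : 'I_n -> R) :
  A \is hermsymmx -> eigenvalues_of A lambda ->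
  exists2 U : 'M[C]_n, U \is unitarymx & A = U^t* *m realdiag lambda *m U.
Proof.
move=> hA eA; have /orthomx_spectralP := hermitian_normalmx hA.
set P := spectralmx A; set d := spectral_diag A => AE.
have hP : P \is unitarymx by apply: spectral_unitarymx.
have pE : perm_eq [seq (lambda i)%:C | i <- enum 'I_n] [tuple d 0 i | i < n].
  apply: prod_XsubC_eq; rewrite big_map big_enum -eA AE.
  rewrite char_poly_conj ?unitarymx_unit // char_poly_trig ?diag_mx_is_trig //.
  rewrite big_tuple; apply: eq_bigr => i _.
  by rewrite !mxE eqxx mulr1n tnth_mktuple.
have [s sE] := tuple_permP pE.
have lE i : (lambda i)%:C = d 0 (s i).
  have := congr1 (fun t => nth 0 t i) sE.
  rewrite (nth_map i) ?size_enum_ord // nth_ord_enum => ->.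
  by rewrite -tnth_nth !tnth_mktuple.
have hS : (perm_mx s : 'M[C]_n) \is unitarymx.
  by apply/unitarymxP; rewrite tr_perm_mx map_perm_mx -perm_mxM mulgV perm_mx1.
exists (perm_mx s *m P); first exact: mul_unitarymx.
rewrite AE invmx_unitary // adjM !mulmxA; congr (_ *m P).
rewrite -!mulmxA; congr (_ *m _).
rewrite tr_perm_mx map_perm_mx !mulmxA -row_permE.
rewrite -[X in _ *m perm_mx X]invgK -col_permE.
apply/matrixP => i j; rewrite !mxE lE permKV.
case: eqVneq => [->|ij]; first by rewrite eqxx.
by rewrite (inj_eq perm_inj) (negPf ij).
Qed.

(** * Forms and kernels of diagonalised matrices *)

Lemma realdiag_form {n} {U A : 'M[C]_n} {lambda : 'I_n -> R} (x : 'cV[C]_n) :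
  A = U^t* *m realdiag lambda *m U ->
  (x^t* *m A *m x) 0 0 = \sum_i (lambda i)%:C * `|(U *m x) i 0| ^+ 2.
Proof.
move=> ->.
have -> : x^t* *m (U^t* *m realdiag lambda *m U) *m x =
    (U *m x)^t* *m realdiag lambda *m (U *m x) by rewrite adjM !mulmxA.
by rewrite diag_form; apply: eq_bigr => i _; rewrite mxE.
Qed.

Lemma realdiag_sum_gt0 {n} {V : 'M[C]_n} (g : 'I_n -> R) (x : 'cV[C]_n) :
  V \is unitarymx -> (forall j, 0 < g j) -> x != 0 ->
  0 < \sum_j (g j)%:C * `|(V *m x) j 0| ^+ 2.
Proof.
move=> hV g0 x0.
have t0 j : true -> 0 <= (g j)%:C * `|(V *m x) j 0| ^+ 2.
  by rewrite mulr_ge0 ?exprn_ge0 // ler0c ltW.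
rewrite lt_def sumr_ge0 // andbT psumr_eq0 //; apply: contra x0 => /allP z.
rewrite -sqnorm_eq0 -(sqnorm_unitary x hV); apply/eqP/big1 => j _; apply/eqP.
have := z j (mem_index_enum _); rewrite mulf_eq0 => /orP[|//].
by rewrite (inj_eq (@complexI R) (g j) 0) gt_eqF.
Qed.

Lemma realdiag_form_le {n} {V D : 'M[C]_n} {mu : 'I_n -> R} (T : {set 'I_n})
    (t : R) (x : 'cV[C]_n) :
  V \is unitarymx -> D = V^t* *m realdiag mu *m V ->
  (forall j, j \in T -> mu j <= t) ->
  (forall j, j \notin T -> (V *m x) j 0 = 0) ->
  (x^t* *m D *m x) 0 0 <= t%:C * sqnorm x.
Proof.
move=> hV DE le_t Vx; rewrite (realdiag_form x DE) -(sqnorm_unitary x hV).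
rewrite mulr_sumr; apply: ler_sum => j _.
case: (boolP (j \in T)) => [/le_t lej|/Vx ->].
  by rewrite ler_wpM2r ?exprn_ge0 // lecR.
by rewrite normr0 expr0n !mulr0.
Qed.

(** Only the coordinates in [T] contribute, with positive weights in the
    opposite of the form; giving the vanishing coordinates the weight [1]
    reduces the claim to [realdiag_sum_gt0]. *)
Lemma realdiag_form_lt0 {n} {V D : 'M[C]_n} {mu : 'I_n -> R} (T : {set 'I_n})
    (x : 'cV[C]_n) :
  V \is unitarymx -> D = V^t* *m realdiag mu *m V -> x != 0 ->
  (forall j, j \in T -> mu j < 0) ->
  (forall j, j \notin T -> (V *m x) j 0 = 0) ->
  (x^t* *m D *m x) 0 0 < 0.
Proof.
move=> hV DE x0 muT Vx; rewrite -oppr_gt0 (realdiag_form x DE).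
pose g j := if j \in T then - mu j else 1.
have g0 j : 0 < g j by rewrite /g; case: ifP => // /muT; rewrite oppr_gt0.
have := realdiag_sum_gt0 g x hV g0 x0; congr (0 < _).
rewrite -sumrN; apply: eq_bigr => j _; rewrite /g.
case: ifPn => [_|/Vx ->]; first by rewrite rmorphN mulNr.
by rewrite normr0 expr0n !mulr0 oppr0.
Qed.

Lemma dim_ker_realdiag {m} {V D : 'M[C]_m} (mu : 'I_m -> R) :
  V \is unitarymx -> D = V^t* *m realdiag mu *m V ->
  dim_ker D = #|[set j | mu j == 0]|.
Proof.
move=> hV ->; have uV := unitarymx_unit hV.
rewrite /dim_ker mxrank_coker mxrankMfree ?row_free_unit // -invmx_unitary //.
rewrite eqmxMfull ?row_full_unit ?unitmx_inv // rank_diag_mx.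
have -> : [set i | (\row_j (mu j)%:C) 0 i != 0] = ~: [set j | mu j == 0].
  by apply/setP => j; rewrite !inE mxE (inj_eq (@complexI R) (mu j) 0).
by have := cardsC [set j | mu j == 0]; rewrite card_ord; lia.
Qed.

(** * Forms of congruent matrices and the spectral norm *)

Lemma form_congr {n m} (A : 'M[C]_n) (D : 'M[C]_m) (K : 'M[C]_(n, m))
    (x : 'cV[C]_m) :
  (x^t* *m (D + K^t* *m A *m K) *m x) 0 0 =
  (x^t* *m D *m x) 0 0 + ((K *m x)^t* *m A *m (K *m x)) 0 0.
Proof. by rewrite adjM mulmxDr mulmxDl mxE !mulmxA. Qed.

Lemma hermsymmx_congr {n m} (A : 'M[C]_n) (D : 'M[C]_m) (K : 'M[C]_(n, m)) :
  A \is hermsymmx -> D \is hermsymmx -> D + K^t* *m A *m K \is hermsymmx.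
Proof.
rewrite !hermsymmxE => /eqP hA /eqP hD.
by rewrite linearD /= map_mxD !adjM trmxCK -hA -hD mulmxA.
Qed.

(** The largest singular value is the operator norm: in a unitary basis
    diagonalising [K^* K], the squared norm of [K x] is the sum of the squared
    moduli of the coordinates of [x], weighted by the squared singular values,
    and each of these weights is attained at a basis vector. *)
Lemma spectral_norm_leP {n m} {K : 'M[C]_(n, m)} {kappa : R} : 0 <= kappa ->
  (spectral_norm K <= kappa) <->
  (forall x : 'cV[C]_m, sqnorm (K *m x) <= (kappa ^+ 2)%:C * sqnorm x).
Proof.
move=> k0; set G := K^t* *m K.
have hG : G \is hermsymmx by rewrite hermsymmxE adjM trmxCK.
set P := spectralmx G; pose d j := complex.Re (spectral_diag G 0 j).
have hP : P \is unitarymx by apply: spectral_unitarymx.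
have GE : G = P^t* *m realdiag d *m P.
  have /orthomx_spectralP {1}-> := hermitian_normalmx hG.
  rewrite invmx_unitary // -/P; congr (_ *m diag_mx _ *m _).
  apply/rowP => j; rewrite mxE RRe_real //.
  exact: (mxOverP (hermitian_spectral_diag_real hG)).
have KE x : sqnorm (K *m x) = \sum_j (d j)%:C * `|(P *m x) j 0| ^+ 2.
  by rewrite -(realdiag_form x GE) sqnormE adjM !mulmxA.
have svE j : (singular_value K j <= kappa) = (d j <= kappa ^+ 2).
  by rewrite -{1}(ger0_norm k0) -sqrtr_sqr ler_sqrt // sqr_ge0.
split=> [/bigmax_leP [_ le_k] x | le_k].
  rewrite KE -(sqnorm_unitary x hP) mulr_sumr; apply: ler_sum => j _.
  by rewrite ler_wpM2r ?exprn_ge0 // lecR -svE le_k.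
apply/bigmax_leP; split=> // j _; rewrite svE -lecR.
pose e : 'cV[C]_m := delta_mx j 0.
have sume (f : 'I_m -> C) : \sum_i f i * `|e i 0| ^+ 2 = f j.
  rewrite (bigD1 j) //= big1 => [|i ij].
    by rewrite mxE !eqxx normr1 expr1n mulr1 addr0.
  by rewrite mxE (negPf ij) normr0 expr0n mulr0.
have Pe : P *m (P^t* *m e) = e by rewrite mulmxA (unitarymxP hP) mul1mx.
have := le_k (P^t* *m e); rewrite KE Pe sume -(sqnorm_unitary _ hP) Pe.
have -> : sqnorm e = 1.
  by rewrite -[RHS](sume (fun=> 1)); apply: eq_bigr => i _; rewrite mul1r.
by rewrite mulr1.
Qed.

(** * Necessity: dimension counting *)

(** If [#|T|] were larger, the equations [(V x)_j = 0] for [j] outside [T] and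
    [(U K x)_i = 0] for [c < lambda i] would be fewer than the [m] unknowns, so
    they would have a nonzero common solution [x]; only eigenvalues at most [c]
    contribute to the form of [A] at [K x], against the hypothesis. *)
Lemma inertia_bound {n m} {U A : 'M[C]_n} {lambda : 'I_n -> R}
    (V : 'M[C]_m) (K : 'M[C]_(n, m)) (T : {set 'I_m}) (c : R) :
  U \is unitarymx -> A = U^t* *m realdiag lambda *m U ->
  (forall x : 'cV[C]_m, x != 0 -> (forall j, j \notin T -> (V *m x) j 0 = 0) ->
    c%:C * sqnorm (K *m x) < ((K *m x)^t* *m A *m (K *m x)) 0 0) ->
  (#|T| <= #|[set i | (c < lambda i)%R]|)%N.
Proof.
move=> hU AE posA; set S := [set i | _]; rewrite leqNgt; apply/negP => ltST.
pose M : 'M[C]_(#|~: T|, m) := rowsub enum_val V.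
pose N : 'M[C]_(#|S|, m) := rowsub enum_val (U *m K).
have lt_m : (#|~: T| + #|S| < m)%N.
  by have := cardsC T; rewrite card_ord; lia.
have [x [x0 Mx Nx]] := exists_common_zero M N lt_m.
have Vx j : j \notin T -> (V *m x) j 0 = 0.
  rewrite -in_setC => jT.
  have := congr1 (fun X : 'cV__ => X (enum_rank_in jT j) 0) Mx.
  by rewrite mul_rowsub_mx !mxE enum_rankK_in.
have Ux i : i \in S -> (U *m (K *m x)) i 0 = 0.
  move=> iS; have := congr1 (fun X : 'cV__ => X (enum_rank_in iS i) 0) Nx.
  by rewrite mul_rowsub_mx mulmxA !mxE enum_rankK_in.
have := posA x x0 Vx; rewrite (realdiag_form _ AE) => /lt_geF/negbT/negP; apply.
rewrite -(sqnorm_unitary (K *m x) hU) mulr_sumr; apply: ler_sum => i _.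
case: (boolP (i \in S)) => [/Ux ->|]; first by rewrite normr0 expr0n !mulr0.
by rewrite inE -leNgt => ci; rewrite ler_wpM2r ?exprn_ge0 // lecR.
Qed.

(** Applies [inertia_bound] to the [j + 1] lowest eigenvectors of [D]: since
    [c >= 0], the bound [|K x| <= kappa |x|] turns the multiple of [|x|^2] in
    the hypothesis into a multiple of [|K x|^2].  Parts (i) and (ii) only differ
    in which of the inequalities supplying that hypothesis is strict. *)
Lemma eigenvalue_bound {n m} {U A : 'M[C]_n} {lambda : 'I_n -> R}
    {V D : 'M[C]_m} {mu : 'I_m -> R} (K : 'M[C]_(n, m)) (kappa c : R)
    (i : 'I_n) (j : 'I_m) :
  U \is unitarymx -> A = U^t* *m realdiag lambda *m U ->
  V \is unitarymx -> D = V^t* *m realdiag mu *m V ->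
  (forall a b : 'I_n, (a <= b)%N -> lambda b <= lambda a) ->
  (forall a b : 'I_m, (a <= b)%N -> mu a <= mu b) ->
  (forall x, sqnorm (K *m x) <= (kappa ^+ 2)%:C * sqnorm x) ->
  i = j :> nat -> 0 <= c ->
  (forall x : 'cV[C]_m, x != 0 ->
    (x^t* *m D *m x) 0 0 <= (mu j)%:C * sqnorm x ->
    (c * kappa ^+ 2)%:C * sqnorm x < ((K *m x)^t* *m A *m (K *m x)) 0 0) ->
  c < lambda i.
Proof.
move=> hU AE hV DE dlam dmu leK ij c0 posA.
pose T := [set a : 'I_m | (a < j.+1)%N].
have cT : #|T| = j.+1 by rewrite card_ltn_ord.
have : (i < #|[set i | (c < lambda i)%R]|)%N.
  rewrite ij -cT; apply: (inertia_bound V K T c hU AE) => x x0 Vx.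
  apply: le_lt_trans (posA x x0 _).
    by rewrite rmorphM -mulrA ler_wpM2l // ler0c.
  apply: (realdiag_form_le T _ x hV DE) => // a; rewrite inE ltnS; exact: dmu.
rewrite -mem_initial ?inE // => a b /dlam le_ab; rewrite !inE => /lt_le_trans.
exact.
Qed.

(** * Sufficiency: a diagonal choice of K *)

Lemma sum_at_most_one {m} (b : pred 'I_m) (y : 'I_m -> C) :
  (forall j j', b j -> b j' -> j = j') ->
  \sum_j (b j)%:R * y j = if [pick j | b j] is Some j then y j else 0.
Proof.
move=> ub; case: pickP => [j bj|b0]; last first.
  by rewrite big1 // => j _; rewrite b0 mul0r.
rewrite (bigD1 j) //= big1 => [|j' jj]; first by rewrite bj mul1r addr0.
rewrite (_ : b j' = false) ?mul0r //; apply: contraNF jj => bj'.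
by rewrite (ub _ _ bj' bj).
Qed.

(** Take [K = s U^* pid_mx(q) V], where [pid_mx q] is the rectangular partial
    identity.  The inner sum has at most one term, namely [lambda i] for the
    [i : 'I_n] with the value of [j]; writing it as a sum covers at once the
    case [q <= j] and the case where [j] is no index of [lambda]. *)
Lemma exists_diagonal_shift {n m} {U A : 'M[C]_n} {lambda : 'I_n -> R}
    {V D : 'M[C]_m} {mu : 'I_m -> R} (q : nat) (s : R) :
  U \is unitarymx -> A = U^t* *m realdiag lambda *m U ->
  V \is unitarymx -> D = V^t* *m realdiag mu *m V -> 0 <= s ->
  exists K : 'M[C]_(n, m), spectral_norm K <= s /\ forall x : 'cV[C]_m,
    (x^t* *m (D + K^t* *m A *m K) *m x) 0 0 = \sum_j (mu j +
      s ^+ 2 * \sum_(i < n | (i == j :> nat) && (i < q)%N) lambda i)%:C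
      * `|(V *m x) j 0| ^+ 2.
Proof.
move=> hU AE hV DE s0.
pose b (i : 'I_n) (j : 'I_m) := (i == j :> nat) && (i < q)%N.
pose K : 'M[C]_(n, m) := U^t* *m (s%:C *: pid_mx q) *m V.
have UK x i : `|(U *m (K *m x)) i 0| ^+ 2 =
    \sum_j (b i j)%:R * ((s ^+ 2)%:C * `|(V *m x) j 0| ^+ 2).
  have -> : U *m (K *m x) = s%:C *: (pid_mx q *m (V *m x)).
    by rewrite !mulmxA (unitarymxP hU) mul1mx -!scalemxAl.
  have ub (j j' : 'I_m) : b i j -> b i j' -> j = j'.
    move=> /andP[/eqP ij _] /andP[/eqP ij' _].
    by apply: val_inj; rewrite /= -ij.
  rewrite mxE mxE normrM exprMn ger0_norm ?ler0c // -rmorphXn.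
  rewrite (eq_bigr (fun j => (b i j)%:R * (V *m x) j 0)) => [|j _]; last first.
    by rewrite [pid_mx _ _ _]mxE.
  rewrite !sum_at_most_one //; case: pickP => // _.
  by rewrite normr0 expr0n mulr0.
exists K; split=> [|x].
  apply/(spectral_norm_leP s0) => x.
  rewrite -(sqnorm_unitary _ hU) -(sqnorm_unitary x hV) /sqnorm.
  under eq_bigr do rewrite UK.
  rewrite exchange_big mulr_sumr; apply: ler_sum => j _.
  have s2 : 0 <= (s ^+ 2)%:C * `|(V *m x) j 0| ^+ 2.
    by rewrite mulr_ge0 ?exprn_ge0 // ler0c sqr_ge0.
  rewrite sum_at_most_one => [|i i']; first by case: pickP.
  by move=> /andP[/eqP ij _] /andP[/eqP ij' _]; apply: val_inj; rewrite /= ij.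
rewrite form_congr (realdiag_form _ DE) (realdiag_form _ AE).
under [X in _ + X]eq_bigr do rewrite UK mulr_sumr.
rewrite exchange_big -big_split; apply: eq_bigr => j _ /=.
rewrite rmorphD mulrDl mulr_sumr rmorph_sum mulr_suml; congr (_ + _).
rewrite [RHS]big_mkcond; apply: eq_bigr => i _; rewrite -/(b i j).
by case: (b i j); rewrite ?rmorphM /=; ring.
Qed.

(** Every [s] works whose square lies strictly between [kappa^2] and the largest
    of the thresholds [- mu j / l j] over [l j > 0]; the default [0] of the
    maximum makes the square positive.  When [l j = 0] the hypothesis at [j]
    already says [0 < mu j]. *)
Lemma exists_smaller_scale {m} (l mu : 'I_m -> R) (kappa : R) : 0 < kappa ->
  (forall j, 0 <= l j) -> (forall j, 0 < mu j + kappa ^+ 2 * l j) ->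
  exists s, [/\ 0 <= s, s < kappa & forall j, 0 < mu j + s ^+ 2 * l j].
Proof.
move=> k0 l0 pos; have k2 : 0 < kappa ^+ 2 by rewrite exprn_gt0.
pose rho := \big[Num.max/0]_(j | 0 < l j) (- mu j / l j).
have rho0 : 0 <= rho by apply: bigmax_ge_id.
have rhok : rho < kappa ^+ 2.
  by apply: bigmax_lt => // j lj; rewrite ltr_pdivrMr //; have := pos j; lra.
pose t := (rho + kappa ^+ 2) / 2.
have t0 : 0 <= t by rewrite /t; lra.
exists (Num.sqrt t); split; first exact: sqrtr_ge0.
  rewrite -(ger0_norm (ltW k0)) -sqrtr_sqr ltr_sqrt // /t; lra.
move=> j; rewrite sqr_sqrtr //; have := l0 j; rewrite le0r => /orP[/eqP lj|lj].
  by have := pos j; rewrite lj !mulr0.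
suff : - mu j / l j < t by rewrite ltr_pdivrMr //; lra.
have : - mu j / l j <= rho by apply: le_bigmax_cond.
rewrite /t; lra.
Qed.

Lemma sum_initial_match {n m} (F : 'I_n -> R) (q : nat) (j : 'I_m) :
  (q <= n)%N ->
  (exists2 i : 'I_n, (i = j :> nat) /\ (j < q)%N &
    \sum_(i < n | (i == j :> nat) && (i < q)%N) F i = F i) \/
  ((q <= j)%N /\ \sum_(i < n | (i == j :> nat) && (i < q)%N) F i = 0).
Proof.
move=> le_qn; case: (ltnP j q) => [lt_jq|le_qj]; [left|right].
  exists (Ordinal (leq_trans lt_jq le_qn)) => //.
  rewrite (big_pred1 (Ordinal (leq_trans lt_jq le_qn))) // => i.
  rewrite /= -val_eqE /=; case: eqVneq => [->|//]; exact: lt_jq.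
split=> //; rewrite big_pred0 // => i; apply/negP => /andP[/eqP ->].
by rewrite ltnNge le_qj.
Qed.

End Spectral.

(** * Definiteness of D + K^* A K *)

Theorem theorem3p3 (R : realType) (n m : nat)
  (A : 'M[R[i]]_n) (D : 'M[R[i]]_m)
  (hA : A \is hermsymmx) (hD : D \is hermsymmx)
  (lambda : 'I_n -> R) (mu : 'I_m -> R)
  (hlambda : eigenvalues_of A lambda)
  (lambda_noninc : forall i j : 'I_n, (i <= j)%N -> lambda j <= lambda i)
  (hmu : eigenvalues_of D mu)
  (mu_nondec : forall i j : 'I_m, (i <= j)%N -> mu i <= mu j)
  (k r p : nat)
  (hk : k = #|[set i : 'I_n | 0 < lambda i]|)
  (hr : r = #|[set i : 'I_m | mu i <= 0]|)
  (hp : p = dim_ker D)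
  (kappa : R) (hkappa : 0 < kappa) :
  ((exists K : 'M[R[i]]_(n, m),
       spectral_norm K < kappa /\ posdefmx (D + K^t* *m A *m K))
   <->
   ((r <= k)%N /\
    forall (i : 'I_n) (j : 'I_m), i = j :> nat -> (i < r - p)%N ->
      0 < kappa ^+ 2 * lambda i + mu j))
  /\
  ((exists K : 'M[R[i]]_(n, m),
       spectral_norm K <= kappa /\ possemidefmx (D + K^t* *m A *m K))
   <->
   ((r - p <= k)%N /\
    forall (i : 'I_n) (j : 'I_m), i = j :> nat -> (i < r - p)%N ->
      0 <= kappa ^+ 2 * lambda i + mu j)).
Proof.
have [U hU AE] := eigenvalues_diagonalize A lambda hA hlambda.
have [V hV DE] := eigenvalues_diagonalize D mu hD hmu.
have kE (i : 'I_n) : (0 < lambda i) = (i < k)%N.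
  rewrite hk -mem_initial ?inE // => a b /lambda_noninc le_ab.
  by rewrite !inE => /lt_le_trans; apply.
have rE (j : 'I_m) : (mu j <= 0) = (j < r)%N.
  rewrite hr -mem_initial ?inE // => a b /mu_nondec le_ab.
  by rewrite !inE; apply: le_trans.
have rpE : (r - p)%N = #|[set j | mu j < 0]|.
  rewrite hp (dim_ker_realdiag mu hV DE) hr.
  rewrite -(cardsID [set j | mu j == 0] [set j | mu j <= 0]).
  have -> : [set j | mu j <= 0] :&: [set j | mu j == 0] = [set j | mu j == 0].
    apply/setP => j; rewrite !inE.
    by case: eqVneq => [->|]; rewrite ?lexx ?andbF.
  rewrite addKn; apply: eq_card => j; rewrite !inE lt_neqAle; congr (_ && _).
have mE (j : 'I_m) : (mu j < 0) = (j < r - p)%N.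
  rewrite rpE -mem_initial ?inE // => a b /mu_nondec le_ab.
  by rewrite !inE; apply: le_lt_trans.
have k2 : 0 < kappa ^+ 2 by rewrite exprn_gt0.
have le_kn : (k <= n)%N by rewrite hk (leq_trans (max_card _)) ?card_ord.
have normP (K : 'M[R[i]]_(n, m)) := @spectral_norm_leP R n m K _ (ltW hkappa).
split; split.
- case=> K [/ltW /normP leK [_ posK]]; split.
    rewrite hk hr; apply: (inertia_bound V K _ 0 hU AE) => x x0 Vx.
    have := posK x x0; rewrite form_congr mul0r => /lt_le_trans; apply.
    rewrite gerDr -(mul0r (sqnorm x)).
    apply: (realdiag_form_le _ 0 x hV DE _ Vx) => j; by rewrite inE.
  move=> i j ij lt_j; rewrite ij -mE in lt_j.
  have : - mu j / kappa ^+ 2 < lambda i.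
    apply: (eigenvalue_bound K kappa _ i j hU AE hV DE) => //.
      by rewrite divr_ge0 ?ltW // oppr_gt0.
    move=> x x0 leD; have := posK x x0; rewrite form_congr divfK ?gt_eqF //.
    move=> posx; rewrite rmorphN mulNr -subr_gt0 opprK addrC.
    by apply: lt_le_trans posx _; rewrite lerD2r.
  by rewrite ltr_pdivrMr //; lra.
- case=> le_rk pos; have le_rn := leq_trans le_rk le_kn.
  pose l (j : 'I_m) := \sum_(i < n | (i == j :> nat) && (i < r)%N) lambda i.
  have [|j|s [s0 s_lt posl]] := exists_smaller_scale l mu kappa hkappa.
  + move=> j; rewrite /l.
    have [[i [ij lt_jr] ->]|[_ ->]//] := sum_initial_match lambda r j le_rn.
    by rewrite ltW // kE ij (leq_trans lt_jr).
  + rewrite /l.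
    have [[i [ij lt_jr] ->]|[le_rj ->]] := sum_initial_match lambda r j le_rn.
      case: (ltnP i (r - p)) => [/(pos i j ij)|]; first by rewrite addrC.
      (* for r - p <= j < r the eigenvalue mu j vanishes, but lambda i > 0 *)
      rewrite ij leqNgt -mE -leNgt => mu0.
      by rewrite ltr_wpDl // mulr_gt0 // kE ij (leq_trans lt_jr).
    by rewrite mulr0 addr0 ltNge rE -leqNgt.
  have [K [normK KE]] := exists_diagonal_shift r s hU AE hV DE s0.
  exists K; split; first exact: le_lt_trans normK s_lt.
  split=> [|x x0]; first exact: hermsymmx_congr.
  rewrite KE; exact: realdiag_sum_gt0.
- case=> K [/normP leK [_ posK]]; split.
    rewrite hk rpE; apply: (inertia_bound V K _ 0 hU AE) => x x0 Vx.
    have := posK x; rewrite form_congr mul0r => /le_lt_trans; apply.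
    rewrite gtrDr; apply: (realdiag_form_lt0 _ x hV DE x0 _ Vx) => j.
    by rewrite inE.
  move=> i j ij lt_j; rewrite ij -mE in lt_j.
  suff : - mu j / kappa ^+ 2 <= lambda i by rewrite ler_pdivrMr //; lra.
  rewrite leNgt; apply/negP => lt_lam.
  (* were lambda i too small, c = max(0, lambda i) would satisfy the hypotheses
     of eigenvalue_bound, whose conclusion lambda i > c is absurd *)
  pose c := Num.max 0 (lambda i).
  have lt_c : c < - mu j / kappa ^+ 2.
    by rewrite /c maxElt; case: ifP => // _; rewrite divr_gt0 // oppr_gt0.
  have : c < lambda i.
    apply: (eigenvalue_bound K kappa _ i j hU AE hV DE) => //.
      by rewrite /c le_max lexx.
    move=> x x0 leD; have := posK x; rewrite form_congr => posx.
    apply: (@lt_le_trans _ _ ((- mu j)%:C * sqnorm x)).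
      by rewrite ltr_pM2r ?sqnorm_gt0 // ltcR -ltr_pdivlMr.
    rewrite rmorphN mulNr -subr_ge0 opprK addrC; apply: le_trans posx _.
    by rewrite lerD2r.
  by rewrite /c gt_max ltxx andbF.
- case=> le_rk pos.
  have [K [normK KE]] :=
    exists_diagonal_shift (r - p) kappa hU AE hV DE (ltW hkappa).
  exists K; split=> //; split; first exact: hermsymmx_congr.
  move=> x; rewrite KE; apply: sumr_ge0 => j _.
  rewrite mulr_ge0 ?exprn_ge0 // ler0c.
  have [[i [ij lt_j] ->]|[le_j ->]] :=
      sum_initial_match lambda (r - p) j (leq_trans le_rk le_kn).
    by rewrite addrC pos // ij.
  by rewrite mulr0 addr0 leNgt mE -leqNgt.
Qed.
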